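(* Let $(X,d)$ be a complete metric space, let $(\Lambda,d_\Lambda)$ be a complete metric space, and let $\{S_\lambda(\cdot):\lambda\in\Lambda\}$ be a parametrised family of semigroups on $X$ satisfying either (L1), (L2) and (L3), or (L1), (L2$'$) and (L3$'$) (these conditions are stated in the context). Then $\mathscr{A}_\lambda$ is continuous in $\lambda$ (with respect to $d_{\rm H}$) at every $\lambda_0$ in a residual subset of $\Lambda$. In particular, the set of continuity points of $\lambda\mapsto\mathscr{A}_\lambda$ is dense in $\Lambda$.
   Context: A semigroup $\{S(t)\}_{t\ge 0}$ on a complete metric space $(X,d)$ is a collection of maps $S(t):X\to X$ such that: (S1) $S(0)=\mathrm{id}$; (S2) $S(t+s)=S(t)S(s)=S(s)S(t)$ for all $t,s\ge 0$; (S3) $S(t)x$ is continuous in $x$ and $t$. For $A,B\subset X$ the semi-distance is $\rho_X(A,B)=\sup_{a\in A}\inf_{b\in B}d(a,b)$, and the symmetric Hausdorff distance is $d_{\rm H}(A,B)=\max(\rho_X(A,B),\rho_X(B,A))$. A compact set $\mathscr{A}\subset X$ is the global attractor for $S(\cdot)$ if (A1) $S(t)\mathscr{A}=\mathscr{A}$ for all $t\ge 0$; and (A2) for any bounded set $B\subset X$, $\rho_X(S(t)B,\mathscr{A})\to 0$ as $t\to\infty$. When it exists it is unique. Conditions on the family $S_\lambda(\cdot)$, $\lambda\in\Lambda$: (L1) $S_\lambda(\cdot)$ has a global attractor $\mathscr{A}_\lambda$ for every $\lambda\in\Lambda$. (L2) There is a bounded subset $D$ of $X$ such that $\mathscr{A}_\lambda\subset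 D$ for every $\lambda\in\Lambda$. (L3) For each $t>0$, $S_\lambda(t)x$ is continuous in $\lambda$, uniformly for $x$ in bounded subsets of $X$; i.e. for every $t>0$, $\lambda_0\in\Lambda$, bounded $B\subset X$ and $\epsilon>0$ there is $\delta>0$ such that $d_\Lambda(\lambda,\lambda_0)<\delta$ implies $d(S_\lambda(t)x,S_{\lambda_0}(t)x)<\epsilon$ for all $x\in B$. (L2$'$) and (L3$'$) are the conditions (L2) and (L3) with ''bounded'' replaced by ''compact''. Continuity of $\mathscr{A}_\lambda$ at $\lambda_0$ means $\lim_{\lambda\to\lambda_0}d_{\rm H}(\mathscr{A}_\lambda,\mathscr{A}_{\lambda_0})=0$. A set is nowhere dense if its closure contains no nonempty open set; a set is residual if its complement is a countable union of nowhere dense sets. *)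

(* Defs.v *)
From HB Require Import structures.
From mathcomp Require Import all_boot all_order all_algebra.
From mathcomp Require Import all_classical all_reals all_analysis.

Set Implicit Arguments.
Unset Strict Implicit.
Unset Printing Implicit Defensive.

Import Order.TTheory GRing.Theory Num.Theory.
Import numFieldNormedType.Exports.

Local Open Scope classical_set_scope.
Local Open Scope ring_scope.

(* [completeType] is pointed, so completeness is stated as a property of a
   [metricType]: the spaces below may be empty. *)
Definition complete_metric (R : realType) (X : metricType R) : Prop :=
  forall u : nat -> X, cauchy (u @ \oo) -> exists l : X, u @ \oo --> l.

(* [bounded_set] of the library is restricted to normed spaces. *)
Definition metric_bounded (R : realType) (X : metricType R) (B : set X) : Prop :=
  exists M : R, forall x y, B x -> B y -> mdist x y <= M.

(* The supremum is taken in [0, +oo]: [maxe 0] only matters for [A = set0],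
   where [ereal_sup set0 = -oo]. *)
Definition semidist (R : realType) (X : metricType R) (A B : set X) : \bar R :=
  maxe 0%E
    (ereal_sup [set ereal_inf [set (mdist a b)%:E | b in B] | a in A]).

Definition hausdorff_dist (R : realType) (X : metricType R) (A B : set X)
    : \bar R :=
  maxe (semidist A B) (semidist B A).

(* Times are the nonnegative reals; [S t] for [t < 0] is junk on which nothing
   below depends. *)
Record semigroup (R : realType) (X : metricType R) (S : R -> X -> X) : Prop := {
  semigroup0 : forall x, S 0 x = x ;
  semigroupD : forall t s, 0 <= t -> 0 <= s ->
    S (t + s) = S t \o S s /\ S t \o S s = S s \o S t ;
  semigroup_continuous :
    {within [set p : R * X | 0 <= p.1], continuous (fun p => S p.1 p.2)}
}.

Record global_attractor (R : realType) (X : metricType R) (S : R -> X -> X)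
    (A : set X) : Prop := {
  attractor_compact : compact A ;
  attractor_invariant : forall t, 0 <= t -> S t @` A = A ;
  attractor_attracts : forall B, metric_bounded B ->
    semidist (S t @` B) A @[t --> +oo] --> 0%E
}.

(* In the next two definitions [C] is the class of sets, either
   [@metric_bounded R X] or [@compact X]. *)
Definition attractors_within (R : realType) (X L : metricType R)
    (C : set X -> Prop) (A : L -> set X) : Prop :=
  exists D : set X, C D /\ forall l, A l `<=` D.

Definition continuous_uniformly_on (R : realType) (X L : metricType R)
    (C : set X -> Prop) (S : L -> R -> X -> X) : Prop :=
  forall (t : R) (l0 : L) (B : set X) (e : R), 0 < t -> C B -> 0 < e ->
    exists2 d : R, 0 < d &
      forall l, mdist l l0 < d ->
        forall x, B x -> mdist (S l t x) (S l0 t x) < e.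

Definition hausdorff_continuous_at (R : realType) (X L : metricType R)
    (A : L -> set X) (l0 : L) : Prop :=
  hausdorff_dist (A l) (A l0) @[l --> l0] --> 0%E.

Definition nowhere_dense (T : topologicalType) (A : set T) : Prop :=
  forall U : set T, open U -> U `<=` closure A -> U = set0.

Definition residual (T : topologicalType) (G : set T) : Prop :=
  exists F : nat -> set T,
    (forall n, nowhere_dense (F n)) /\ ~` G = \bigcup_n F n.

(* Main.v *)
Require Import Defs.
From HB Require Import structures.
From mathcomp Require Import all_boot all_order all_algebra.
From mathcomp Require Import all_classical all_reals all_analysis.
From mathcomp Require Import lra.

Import Order.TTheory GRing.Theory Num.Theory.
Import numFieldNormedType.Exports.

Local Open Scope classical_set_scope.
Local Open Scope ring_scope.

(** The attractor is a pointwise limit of continuous set-valued maps, and such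
    a limit is continuous at most points, by Baire's argument.

    Let [D] contain every [A l], and put [f n l = S l (n + 1) D]. Invariance of
    the attractor gives [A l `<=` f n l]; attraction of [D] makes [f n l] close
    to [A l] for some large [n]; uniform continuity of [S l (n + 1)] on [D] with
    respect to [l] makes each [f n] continuous for the Hausdorff distance.

    These three facts ([outer_approximation]) suffice. They give upper
    semicontinuity of [A] everywhere ([approx_upper_semicontinuous]). Lower
    semicontinuity at [l0] follows if, for each [e], some [f n l] is [e]-close
    to [A l] for all [l] in a neighbourhood of [l0]. Let [F] be the closure of
    the set of [l] at which [f n l] is [e]-close to [A l]. By upper
    semicontinuity, [f n l] is still [3e]-close to [A l] on [F]
    ([approx_closure_thickening]), so the interior of [F] is good. For fixed
    [e] the sets [F] cover the parameter space as [n] varies, hence any bad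
    point lies on the boundary of one of them; these boundaries are nowhere
    dense and, with [e = 1 / (k + 1)], countably many
    ([approx_residual_continuous]). Density is Baire's theorem for complete
    metric spaces ([complete_residual_dense]).

    Distances between sets are handled through the inclusions
    [A `<=` thickening B e], which compose by the triangle inequality; the
    extended-real Hausdorff distance only appears when translating the
    hypotheses and the conclusion. *)

(** * Thickenings and Hausdorff distance *)

Definition thickening {R : realType} {X : metricType R} (B : set X) (e : R)
    : set X :=
  [set x | exists2 b, B b & mdist x b < e].

Lemma thickening_trans {R : realType} {X : metricType R} (B A C : set X)
    (e e' : R) :
  A `<=` thickening B e -> B `<=` thickening C e' ->
  A `<=` thickening C (e + e').
Proof.
move=> AB BC a /AB[b /BC[c Cc bc] ab]; exists c => //.
by rewrite (le_lt_trans (metric_triangle a b c))// ltrD.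
Qed.

Lemma semidist_le_thickening {R : realType} {X : metricType R} (A B : set X)
    (e : R) :
  0 <= e -> A `<=` thickening B e -> (semidist A B <= e%:E)%E.
Proof.
move=> e0 AB; rewrite /semidist ge_max lee_fin e0/=.
apply: ge_ereal_sup => _ [a /AB[b Bb ab] <-].
apply: (@le_trans _ _ (mdist a b)%:E); last by rewrite lee_fin ltW.
by apply: ereal_inf_lbound; exists b.
Qed.

Lemma semidist_lt_thickening {R : realType} {X : metricType R} (A B : set X)
    (e : R) :
  (semidist A B < e%:E)%E -> A `<=` thickening B e.
Proof.
rewrite /semidist gt_max => /andP[_ AB] a Aa.
have /ereal_inf_lt[_ [b Bb <-]] :
    (ereal_inf [set (mdist a b)%:E | b in B] < e%:E)%E.
  by apply: le_lt_trans AB; apply: ereal_sup_ubound; exists a.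
by rewrite lte_fin => ab; exists b.
Qed.

Lemma nbhs_mdistP {R : realType} {T : metricType R} (x : T) (P : set T) :
  nbhs x P <-> exists2 d : R, 0 < d & forall y, mdist y x < d -> P y.
Proof.
rewrite -nbhs_ballE; split=> [[d /= d0 dP]|[d d0 dP]]; exists d => //= y xy.
  by apply: dP; rewrite ballEmdist/= metric_sym.
by apply: dP; move: xy; rewrite ballEmdist/= metric_sym.
Qed.

Lemma hausdorff_continuous_at_thickening {R : realType} {X L : metricType R}
    (A : L -> set X) (l0 : L) :
  (forall e, 0 < e -> \forall l \near l0,
     A l `<=` thickening (A l0) e /\ A l0 `<=` thickening (A l) e) ->
  hausdorff_continuous_at A l0.
Proof.
move=> Anear P; rewrite /nbhs/= -nbhs_ballE => -[d /= d0 dP].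
have d20 : 0 < d / 2 by rewrite divr_gt0.
have := Anear _ d20; apply: filterS => l [ll0 l0l].
have : (hausdorff_dist (A l) (A l0) <= (d / 2)%:E)%E.
  by rewrite /hausdorff_dist ge_max !semidist_le_thickening// ltW.
have : (0 <= hausdorff_dist (A l) (A l0))%E.
  by rewrite /hausdorff_dist /semidist !le_max lexx.
rewrite /=; case: (hausdorff_dist _ _) => [r| |]//.
rewrite !lee_fin => r0 rd; apply: dP => /=.
rewrite /ball/= sub0r normrN ger0_norm//.
by rewrite (le_lt_trans rd)// ltr_pdivrMr// ltr_pMr// ltr1n.
Qed.

(** Attractors attract bounded sets, hence through this lemma also a compact set
    containing all of them. *)
Lemma compact_metric_bounded {R : realType} {X : metricType R} (K : set X) :
  compact K -> metric_bounded K.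
Proof.
have [->|/set0P[x0 Kx0]] := eqVneq K set0; first by exists 0.
move=> /compact_near_coveringP/(_ R (pinfty_nbhs R)
  (fun r x => mdist x0 x < r)) cov.
have /cov : forall x, K x ->
    \forall x' \near x & r \near +oo, mdist x0 x' < r.
  move=> x _.
  exists ([set y | mdist y x < 1], [set r : R | mdist x0 x + 1 < r]).
    split; first by apply/nbhs_mdistP; exists 1.
    by exists (mdist x0 x + 1); split; [rewrite num_real|].
  move=> [y r]/= [yx]; apply: le_lt_trans.
  rewrite (le_trans (metric_triangle x0 x y))// lerD2l metric_sym ltW//.
case=> M [_ /(_ (M + 1))]; rewrite ltrDl ltr01 => /(_ isT) KM.
exists (M + 1 + (M + 1)) => x y /KM x0x /KM x0y.
rewrite (le_trans (metric_triangle x x0 y))// lerD// ltW//.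
by rewrite metric_sym.
Qed.

(** * Baire category in complete metric spaces *)

Lemma nowhere_dense_boundary (T : topologicalType) (F : set T) :
  closed F -> nowhere_dense (F `\` F°).
Proof.
move=> cF U oU UF; have UsubF : U `<=` F.
  move=> x /UF; rewrite [X in _ -> X x](iffLR (closure_id F) cF).
  by apply: closureS => y [].
have UF0 : U `<=` F° by rewrite -open_subsetE.
rewrite -subset0 => x Ux.
have [y [[_ nFy] /UF0]] := UF _ Ux _ (open_nbhs_nbhs (conj oU Ux)).
by [].
Qed.

(** The induction step of Baire's theorem. The new disc is closed, so that it
    will contain the limit of the centres; the old ball is open, to be a
    nonempty open set that [closure F] cannot contain. *)
Lemma nowhere_dense_avoid {R : realType} {T : metricType R} (F : set T)
    (x : T) (r e : R) :
  nowhere_dense F -> 0 < r -> 0 < e ->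
  exists y : T, exists s : R, [/\ 0 < s, s <= e &
    forall z, mdist y z <= s -> mdist x z < r /\ ~ F z].
Proof.
move=> ndF r0 e0; pose U := (ball x r)°.
have Ux : U x by apply: nbhsx_ballx.
have [y [Uy nFy]] : exists y, U y /\ ~ closure F y.
  apply: contrapT => noy; have UF : U `<=` closure F.
    by move=> y Uy; apply: contrapT => nFy; apply: noy; exists y.
  by move: Ux; rewrite (ndF U)//; exact: open_interior.
have : open_nbhs y (U `&` ~` closure F).
  split; last by [].
  apply: openI; first exact: open_interior.
  by apply: closed_openC; exact: closed_closure.
move=> /open_nbhs_nbhs/nbhs_mdistP[d d0 dU].
exists y, (Num.min (d / 2) e); split.
- by rewrite lt_min e0 divr_gt0.
- by rewrite ge_min lexx orbT.
- move=> z; rewrite le_min => /andP[yz _].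
  have /dU[/interior_subset xz nFz] : mdist z y < d.
    by rewrite metric_sym (le_lt_trans yz)// ltr_pdivrMr// ltr_pMr// ltr1n.
  split; first by rewrite ballEmdist in xz.
  by move=> Fz; apply: nFz; exact: subset_closure.
Qed.

(** Baire's theorem: nested closed discs, the [n]-th one avoiding the [n]-th
    nowhere dense set, shrink to a point of the residual set. *)
Lemma complete_residual_dense {R : realType} {T : metricType R} (G : set T) :
  complete_metric T -> residual G -> dense G.
Proof.
move=> completeT [F [ndF GF]] O [x0 Ox0] oO.
have /nbhs_mdistP[r0 r00 r0O] := open_nbhs_nbhs (conj oO Ox0).
have step (p : nat * (T * {posnum R})) : exists q : T * {posnum R},
    q.2%:num <= p.1.+1%:R^-1 /\ forall z, mdist q.1 z <= q.2%:num ->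
      mdist p.2.1 z < p.2.2%:num /\ ~ F p.1 z.
  have [y [s [s0 se yF]]] := @nowhere_dense_avoid _ _ (F p.1) p.2.1 p.2.2%:num
    p.1.+1%:R^-1 (ndF _) (gt0 _) (ltac:(by rewrite invr_gt0)).
  by exists (y, PosNum s0).
have [next nextP] := choice step.
pose fix c n := if n is m.+1 then next (m, c m) else (x0, PosNum r00).
have c_step n : (c n.+1).2%:num <= n.+1%:R^-1 /\
    forall z, mdist (c n.+1).1 z <= (c n.+1).2%:num ->
      mdist (c n).1 z < (c n).2%:num /\ ~ F n z := nextP (n, c n).
have c_nest n k z :
    mdist (c (n + k)%N).1 z <= (c (n + k)%N).2%:num ->
    mdist (c n).1 z <= (c n).2%:num.
  elim: k => [|k IH]; first by rewrite addn0.
  by rewrite addnS => /(c_step _).2[/ltW/IH].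
have c_in n m : (n <= m)%N -> mdist (c n).1 (c m).1 <= (c n).2%:num.
  by move=> nm; apply: (c_nest n (m - n)%N); rewrite subnKC// mdistxx.
have [l cl] : exists l : T, (fun n => (c n).1) @ \oo --> l.
  apply: (completeT (fun n => (c n).1)).
  apply: cauchy_exP => e e0.
  have [n ne] : exists n, n.+1%:R^-1 < e.
    have /ltr_add_invr[n] := e0; rewrite add0r => ?; by exists n.
  exists (c n.+1).1; exists n.+1 => // m /= nm; rewrite ballEmdist/=.
  by rewrite (le_lt_trans (c_in _ _ nm))// (le_lt_trans (c_step n).1).
have l_in n : mdist (c n).1 l <= (c n).2%:num.
  apply/ler_addgt0Pl => e e0.
  have /cl : nbhs l [set y | mdist y l < e] by apply/nbhs_mdistP; exists e.
  case=> N _ /(_ (maxn N n))/= /(_ (leq_maxl _ _)) le.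
  rewrite (le_trans (metric_triangle _ (c (maxn N n)).1 _))// addrC.
  by rewrite lerD// ?c_in ?leq_maxr// ltW.
exists l; split.
  by apply: r0O; rewrite metric_sym; have [/=] := (c_step 0%N).2 _ (l_in 1%N).
apply: contrapT => nGl; have : (~` G) l by [].
rewrite GF => -[n _].
by have [] := (c_step n).2 _ (l_in n.+1).
Qed.

(** * Residual continuity of limits of continuous set-valued maps *)

(** What the images [S l (n + 1) D] are to the attractors [A l]. As [f n l]
    contains [A l], [outer_approximation_near] makes [f n l] approach [A l] in the
    Hausdorff distance. *)
Record outer_approximation {R : realType} {X L : metricType R}
    (f : nat -> L -> set X) (A : L -> set X) : Prop := {
  outer_approximation_sub : forall n l, A l `<=` f n l ;
  outer_approximation_near : forall l e, 0 < e ->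
    exists n, f n l `<=` thickening (A l) e ;
  outer_approximation_continuous : forall n l0 e, 0 < e -> \forall l \near l0,
    f n l `<=` thickening (f n l0) e /\ f n l0 `<=` thickening (f n l) e
}.

(** [A l] lies in [f n l], which stays near [f n l0], and [f n l0] is close to
    [A l0] for a suitable [n]. This half of the continuity holds at every
    point. *)
Lemma approx_upper_semicontinuous {R : realType} {X L : metricType R}
    (f : nat -> L -> set X) (A : L -> set X) :
  outer_approximation f A -> forall l0 e, 0 < e ->
  \forall l \near l0, A l `<=` thickening (A l0) e.
Proof.
move=> [Af fA fcont] l0 e e0; have e20 : 0 < e / 2 by rewrite divr_gt0.
have [n fnA] := fA l0 _ e20.
have := fcont n l0 _ e20; apply: filterS => l [ll0 _].
rewrite (splitr e); apply: (thickening_trans (f n l0)) => //.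
exact: subset_trans ll0.
Qed.

(** Closeness of [f n l] to [A l] survives passing to limits in [l], at the
    cost of a factor: at a nearby [l'] where it holds, [f n l] is near
    [f n l'], hence near [A l'], hence near [A l] by upper semicontinuity. *)
Lemma approx_closure_thickening {R : realType} {X L : metricType R}
    (f : nat -> L -> set X) (A : L -> set X) :
  outer_approximation f A -> forall n e, 0 < e ->
  closure [set l | f n l `<=` thickening (A l) e] `<=`
  [set l | f n l `<=` thickening (A l) (e + e + e)].
Proof.
move=> approx n e e0 l /= cl.
have near_l : nbhs l [set l' | f n l `<=` thickening (f n l') e /\
    A l' `<=` thickening (A l) e].
  apply: filterS2 (outer_approximation_continuous _ _ approx n l _ e0)
    (approx_upper_semicontinuous f A approx l _ e0) => l' [_ +] +.
  by split.
have [l' [fAl' [ffl' AAl']]] := cl _ near_l.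
exact: thickening_trans _ _ _ _ _ (thickening_trans _ _ _ _ _ ffl' fAl') AAl'.
Qed.

(** For fixed [k] the closed sets [F n k] cover [L], so a point outside all
    their boundaries is interior to one of them. Near such a point [l0] a
    single index [n] makes [f n l] close to [A l]; then [A l0], contained in
    [f n l0], which is near [f n l], is close to [A l]. This is the missing
    lower semicontinuity. *)
Lemma approx_residual_continuous {R : realType} {X L : metricType R}
    (f : nat -> L -> set X) (A : L -> set X) :
  outer_approximation f A ->
  exists2 G : set L, residual G &
    forall l0, G l0 -> hausdorff_continuous_at A l0.
Proof.
move=> approx; have [Af fA fcont] := approx.
pose F n k := closure [set l | f n l `<=` thickening (A l) k.+1%:R^-1].
pose bad n k := F n k `\` (F n k)°.
pose B i := if unpickle i is Some (n, k) then bad n k else set0.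
exists (~` \bigcup_i B i).
  exists B; split; last by rewrite setCK.
  move=> i; rewrite /B; case: unpickle => [[n k]|].
    by apply: nowhere_dense_boundary; exact: closed_closure.
  by move=> U _; rewrite closure0 subset0.
move=> l0 Gl0; apply: hausdorff_continuous_at_thickening => e e0.
(* Four errors add up below: one from the continuity of [f n], and three from
   [approx_closure_thickening]. *)
have [k ke] : exists k, k.+1%:R^-1 < e / 4.
  have /ltr_add_invr[k] : 0 < e / 4 by rewrite divr_gt0.
  by rewrite add0r => ?; exists k.
have k0 : 0 < k.+1%:R^-1 :> R by rewrite invr_gt0.
have [n fnA] := fA l0 _ k0.
have Fl0 : nbhs l0 (F n k).
  apply: contrapT => nFl0; apply: Gl0; exists (pickle (n, k)) => //.
  by rewrite /B pickleK; split=> //; exact: subset_closure.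
apply: filterS3 Fl0 (fcont n l0 _ k0)
  (approx_upper_semicontinuous f A approx l0 _ e0).
move=> l Fl [_ ffl] AAl; split=> // a /Af-/(_ n) fa.
have [b Ab ab] : thickening (A l)
    (k.+1%:R^-1 + (k.+1%:R^-1 + k.+1%:R^-1 + k.+1%:R^-1)) a.
  apply: (thickening_trans _ _ _ _ _ ffl) fa.
  exact: (approx_closure_thickening f A approx).
exists b => //; apply: (lt_trans ab); move: ke; set t := k.+1%:R^-1 => ke.
lra.
Qed.

(** * Continuity of global attractors *)

Theorem theorem5p2 (R : realType) (X L : metricType R)
    (S : L -> R -> X -> X) (A : L -> set X)
    (completeX : complete_metric X) (completeL : complete_metric L)
    (semigroupS : forall l, semigroup (S l))
    (attractorA : forall l, global_attractor (S l) (A l))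
    (hS : (attractors_within (@metric_bounded R X) A /\
           continuous_uniformly_on (@metric_bounded R X) S) \/
          (attractors_within (@compact X) A /\
           continuous_uniformly_on (@compact X) S)) :
  (exists2 G : set L, residual G &
     forall l0, G l0 -> hausdorff_continuous_at A l0) /\
  dense [set l0 | hausdorff_continuous_at A l0].
Proof.
(* Both alternatives give these facts; the times are [n.+1] because continuity
   in the parameter is given at positive times. *)
have [D [AD Dbounded Scont]] : exists D : set X, [/\ forall l, A l `<=` D,
    metric_bounded D &
    forall n l0 e, 0 < e -> exists2 d : R, 0 < d & forall l, mdist l l0 < d ->
      forall x, D x -> mdist (S l n.+1%:R x) (S l0 n.+1%:R x) < e].
  case: hS => -[[D [DC AD]] Scont]; exists D; split=> //.
  - by move=> n l0 e; apply: Scont.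
  - exact: compact_metric_bounded.
  - by move=> n l0 e; apply: Scont.
have resA : exists2 G : set L, residual G &
    forall l0, G l0 -> hausdorff_continuous_at A l0.
  apply: (approx_residual_continuous (fun n l => S l n.+1%:R @` D)); split.
  (* Invariance of [A l] turns [A l `<=` D] into [A l `<=` S l n.+1 D]. *)
  - move=> n l; rewrite -{1}(attractor_invariant (attractorA l) (ler0n R n.+1)).
    exact: image_subset.
  - move=> l e e0.
    have : nbhs (0%E : \bar R) [set y | (y < e%:E)%E].
      apply: open_nbhs_nbhs; split=> /=; first exact: open_ereal_lt_ereal.
      by rewrite lte_fin.
    move=> /(attractor_attracts (attractorA l) Dbounded)[M [_ attr]].
    exists (Num.truncn M); apply: semidist_lt_thickening.
    by apply: attr; rewrite truncnS_gt.
  - move=> n l0 e e0; have [d d0 Sd] := Scont n l0 e e0.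
    apply/nbhs_mdistP; exists d => // l ll0.
    split=> _ [x Dx <-]; [exists (S l0 n.+1%:R x)|exists (S l n.+1%:R x)].
    + by exists x.
    + exact: Sd.
    + by exists x.
    + by rewrite metric_sym; exact: Sd.
split=> //.
have [G resG GA] := resA.
move=> O O0 oO.
have [l [Ol Gl]] := complete_residual_dense G completeL resG O O0 oO.
by exists l; split=> //; exact: GA.
Qed.
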